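(* Let $E$ be a Borel space and $Q$ a semi-Markov kernel on $\mathbb{R}_+\times E$ given $E$ satisfying the regularity condition: there exist $\delta>0$ and $\epsilon>0$ such that $Q(\delta,E\mid x)\le 1-\epsilon$ for all $x\in E$. Let $c,g:E\to[0,\infty)$ be measurable and fix $T\in\mathbb{R}_+$. Define $D^*=\{(s,x)\in(0,T]\times E: V^*(s,x)=g(x)\}$ and, for $\omega=(x_0,t_1,x_1,\dots,t_n,x_n,\dots)\in\Omega$, $$\tau^*(\omega)=\inf\Big\{n\in\mathbb{N}: \Big(T-\sum_{k=1}^n t_k,\ x_n\Big)\in D^*\Big\}\wedge\inf\Big\{n\in\mathbb{N}: T\le \sum_{k=1}^n t_k\Big\}$$ (with $\inf\emptyset=+\infty$). Then $\tau^*$ is a $T$-optimal stopping time, i.e. $V^{\tau^*}(T,x)=V^*(T,x)$ for all $x\in E$, and $\mathbb{P}_x(\tau^*=\infty)=0$ for all $x\in E$.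
   Context: Semi-Markov kernel: for each $B\in\mathcal{B}(E)$ and $x\in E$, $t\mapsto Q(t,B\mid x)$ is nondecreasing, right-continuous on $\mathbb{R}_+$ with $Q(0,B\mid x)=0$; for each $t$, $Q(t,\cdot\mid\cdot)$ is a substochastic kernel on $E$; $\lim_{t\to\infty}Q(t,\cdot\mid\cdot)$ is a stochastic kernel on $E$. Let $\Omega=\{(x_0,t_1,x_1,t_2,x_2,\dots): x_0\in E,\ (t_n,x_n)\in\mathbb{R}_+\times E\}$ with its product Borel $\sigma$-algebra; $X_n(\omega)=x_n$, $T_0=0$, $T_{n+1}(\omega)=t_{n+1}$, $S_n=\sum_{k=0}^n T_k$, $Y_n=(X_0,T_1,X_1,\dots,T_n,X_n)$, $\mathcal{F}_n=\sigma(T_0,X_0,\dots,T_n,X_n)$. For $x\in E$, $\mathbb{P}_x$ is the unique probability measure on $\Omega$ with $\mathbb{P}_x(T_0=0,X_0=x)=1$ and $\mathbb{P}_x(T_{n+1}\le t,X_{n+1}\in B\mid Y_n)=Q(t,B\mid X_n)$; $\mathbb{E}_x$ is its expectation. The process $X(t)=X_n$ for $S_n\le t<S_{n+1}$. A stopping time is a map $\tau:\Omega\to\mathbb{N}\cup\{+\infty\}$ ($\mathbb{N}=\{0,1,2,\dots\}$) with $\{\tau=n\}\in\mathcal{F}_n$ for all $n$; $\Gamma$ is the set of stopping times. For a horizon $s\in\mathbb{R}_+$ and $\tau\in\Gamma$, $R^s_\tau=\int_0^{S_\tau}c(X(t))\,dt+g(X(S_\tau))$ if $S_\tau<s$ and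 $R^s_\tau=\int_0^s c(X(t))\,dt$ if $S_\tau\ge s$ (with $S_\tau=\lim_n S_n$ on $\{\tau=\infty\}$); $V^\tau(s,x)=\mathbb{E}_x[R^s_\tau]$ and $V^*(s,x)=\inf_{\tau\in\Gamma}V^\tau(s,x)$. A stopping time $\tau^*$ is $T$-optimal if $V^{\tau^*}(T,x)=V^*(T,x)$ for all $x\in E$. *)

(* Defs.v *)
From HB Require Import structures.
From mathcomp Require Import all_boot all_order all_algebra.
From mathcomp Require Import all_classical all_reals all_analysis.
Set Implicit Arguments.
Unset Strict Implicit.
Unset Printing Implicit Defensive.
Import Order.TTheory GRing.Theory Num.Theory.
Import numFieldNormedType.Exports.
Local Open Scope classical_set_scope.
Local Open Scope ring_scope.

(* Borel space (standard Borel space): Borel-isomorphic to a Borel     *)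
(* subset of R (Kuratowski).                                           *)
Definition borel_space {d} (E : measurableType d) (R : realType) : Prop :=
  exists f : E -> R,
    [/\ measurable_fun setT f, injective f, measurable (range f)
      & forall A : set E, measurable A -> measurable (f @` A)].

Section SemiMarkov.
Context {d} {E : measurableType d} {R : realType}.

(* Canonical sample space
   Omega = { (x0, t1, x1, t2, x2, ...) }, encoded as (x0, k |-> (t_{k+1}, x_{k+1})). *)
Definition Omega0 := (E * (nat -> R * E))%type.

Definition Xc (n : nat) (w : Omega0) : E :=
  if n is k.+1 then (w.2 k).2 else w.1.
Definition Tc (n : nat) (w : Omega0) : R :=
  if n is k.+1 then (w.2 k).1 else 0.
Definition Sc (n : nat) (w : Omega0) : R := \sum_(0 <= k < n.+1) Tc k w.

Definition gen_le (n : nat) : set (set Omega0) :=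
  fun A => exists2 k, (k <= n)%N &
    (exists2 B : set E, measurable B & A = Xc k @^-1` B) \/
    (exists2 B : set R, measurable B & A = Tc k @^-1` B).
Definition gen_all : set (set Omega0) := \bigcup_n gen_le n.

Definition Omega := g_sigma_algebraType gen_all.

Definition filtr (n : nat) : set (set Omega) := <<s gen_le n >>.

Definition canonical_law (Q : R -> R.-spker E ~> E)
    (P : E -> probability Omega R) : Prop :=
  forall x : E,
    P x [set w : Omega | Tc 0 w = 0 /\ Xc 0 w = x] = 1%E /\
    (* P_x(T_{n+1} <= t, X_{n+1} in B | Y_n) = Q(t, B | X_n), i.e.
       for every F in F_n = sigma(Y_n) :
       P_x(F /\ T_{n+1} <= t /\ X_{n+1} in B) = E_x[ 1_F Q(t,B|X_n) ] *)
    (forall (n : nat) (t : R) (B : set E) (F : set Omega),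
        0 <= t -> measurable B -> filtr n F ->
        P x (F `&` [set w | Tc n.+1 w <= t /\ B (Xc n.+1 w)]) =
        (\int[P x]_(w in F) Q t (Xc n w) B)%E).

(* stopping times: None stands for +oo *)
Definition stopping_time (tau : Omega -> option nat) : Prop :=
  forall n : nat, filtr n [set w | tau w = Some n].

(* the semi-Markov process X(t) = X_n for S_n <= t < S_{n+1}
   (the default value X_0 is only used off the explosion-free set) *)
Definition Xproc (w : Omega) (t : R) : E :=
  Xc (xget 0%N [set m | Sc m w <= t < Sc m.+1 w]) w.

Definition Stau (tau : Omega -> option nat) (w : Omega) : \bar R :=
  match tau w with
  | Some n => (Sc n w)%:E
  | None => limn (fun n => (Sc n w)%:E)
  end.

Definition run_cost (c : E -> R) (w : Omega) (u : \bar R) : \bar R :=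
  (\int[lebesgue_measure]_(t in [set t : R | (0 <= t)%R /\ (t%:E < u)%E])
      (c (Xproc w t))%:E)%E.

Definition reward (c g : E -> R) (tau : Omega -> option nat) (s : R)
    (w : Omega) : \bar R :=
  if (Stau tau w < s%:E)%E then
    (run_cost c w (Stau tau w) + (g (Xproc w (fine (Stau tau w))))%:E)%E
  else run_cost c w s%:E.

Definition Vtau (P : E -> probability Omega R) (c g : E -> R)
    (tau : Omega -> option nat) (s : R) (x : E) : \bar R :=
  (\int[P x]_w reward c g tau s w)%E.

Definition Vstar (P : E -> probability Omega R) (c g : E -> R)
    (s : R) (x : E) : \bar R :=
  ereal_inf [set Vtau P c g tau s x | tau in stopping_time].

Definition Dstar (P : E -> probability Omega R) (c g : E -> R) (T : R) :
    set (R * E) :=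
  [set sx | 0 < sx.1 <= T /\ Vstar P c g sx.1 sx.2 = (g sx.2)%:E].

Definition first_hit (p : nat -> Prop) : option nat :=
  match pselect (exists n, p n) with
  | left h => Some (@ex_minn (fun n => `[< p n >]) (let: ex_intro n hn := h in
                  ex_intro _ n (asboolT hn)))
  | right _ => None
  end.

Definition omin (a b : option nat) : option nat :=
  match a, b with
  | Some m, Some n => Some (minn m n)
  | Some m, None => Some m
  | None, b => b
  end.

Definition tau_star (P : E -> probability Omega R) (c g : E -> R) (T : R)
    (w : Omega) : option nat :=
  omin (first_hit (fun n => Dstar P c g T (T - Sc n w, Xc n w)))
       (first_hit (fun n => T <= Sc n w)).

Definition semi_markov_kernel (Q : R -> R.-spker E ~> E) : Prop :=
  [/\ (forall (x : E) (B : set E), measurable B ->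
         forall s t : R, 0 <= s <= t -> (Q s x B <= Q t x B)%E),
      (forall (x : E) (B : set E), measurable B ->
         forall t : R, 0 <= t -> Q u x B @[u --> t^'+] --> Q t x B),
      (forall (x : E) (B : set E), measurable B -> Q 0 x B = 0%E)
    & exists Qinf : R.-pker E ~> E,
        forall (x : E) (B : set E), measurable B ->
          Q t x B @[t --> +oo] --> Qinf x B].

End SemiMarkov.

(* Main.v *)
Require Import Defs.
From HB Require Import structures.
From mathcomp Require Import all_boot all_order all_algebra.
From mathcomp Require Import all_classical all_reals all_analysis.
From mathcomp Require Import measurable_realfun.
Import Order.TTheory GRing.Theory Num.Theory.
Import numFieldNormedType.Exports.
Local Open Scope classical_set_scope.
Local Open Scope ring_scope.
Set Implicit Arguments.
Unset Strict Implicit.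
Unset Printing Implicit Defensive.

(* Value iteration u_0 = 0, u_{n+1}(s,x) = min(g(x), E_x[c(x) min(T_1,s) +
   u_n(s - T_1, X_1)]) for s > 0, and 0 for s <= 0, increases to a limit u.
   Off a null set of explosive paths the reward of a stopping rule is a sum of
   nonnegative stage costs.  By the Markov property at each stage, u_n is at most
   the expected cost of the first n stages of any stopping rule, hence u <= V*.
   Where u < g, u dominates its own one-step expectation, so along the first
   hitting time of {u = g} (or of the horizon) the partial expected costs stay
   below u, hence V <= u for that rule.  Therefore u = V* and this hitting time is
   tau*.  No fixed-point uniqueness is needed, so unbounded c and g are allowed;
   regularity serves only to make S_n tend to infinity almost surely. *)

(** * Integration lemmas *)

Section nonmeasurable_integrand.
Local Open Scope ereal_scope.
Context d (T : measurableType d) (R : realType).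
Variable mu : {measure set T -> \bar R}.
Import HBNNSimple.

(** The integral of a nonnegative function is a supremum over simple functions below it. Multiplying
    such a simple function by the indicator of the complement of [N] keeps its integral and brings
    it below [g]. *)
Lemma ge0_le_integral_off_null (f g : T -> \bar R) (N : set T) :
  measurable N -> mu N = 0 -> (forall x, 0 <= f x) -> (forall x, 0 <= g x) ->
  (forall x, ~ N x -> f x <= g x) -> \int[mu]_x f x <= \int[mu]_x g x.
Proof.
move=> mN N0 f0 g0 fg; rewrite !ge0_integralTE//.
apply: ge_ereal_sup => _ [h /= hf] <-.
have mNc := measurableC mN.
pose h' := proj_nnsfun h mNc.
have -> : sintegral mu h = sintegral mu h'.
  rewrite -!integralT_nnsfun; apply: ge0_ae_eq_integral => //.
  - exact/measurable_EFinP.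
  - exact/measurable_EFinP.
  - by move=> x _; rewrite lee_fin.
  - by move=> x _; rewrite lee_fin.
  exists N; split => // x /=; apply: contra_notP => Nx _.
  by rewrite /h' /= mindicE mem_set// mulr1.
apply: ereal_sup_ubound; exists h' => // x /=.
rewrite mindicE; have [Nx|Nx] := boolP (x \in ~` N); last by rewrite mulr0.
by rewrite mulr1 (le_trans (hf x))// fg//; exact: set_mem Nx.
Qed.

(* The integral of a non-measurable function is a lower integral, which still
   ignores measurable null sets; [reward] need not be measurable on the null
   set of explosive paths. *)
Lemma ge0_eq_integral_off_null (f g : T -> \bar R) (N : set T) :
  measurable N -> mu N = 0 -> (forall x, 0 <= f x) -> (forall x, 0 <= g x) ->
  (forall x, ~ N x -> f x = g x) -> \int[mu]_x f x = \int[mu]_x g x.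
Proof.
move=> mN N0 f0 g0 fg; apply/eqP; rewrite eq_le; apply/andP; split.
  by apply: (@ge0_le_integral_off_null _ _ N) => // x /fg->.
by apply: (@ge0_le_integral_off_null _ _ N) => // x /fg->.
Qed.

End nonmeasurable_integrand.

(** Closed left rays are the right generators here because [canonical_law] prescribes only events of
    the form [Tc n.+1 w <= t]. *)
Lemma measurable_rays (R : realType) :
  @measurable _ R = <<s [set A : set R | exists t : R, A = [set s | s <= t]] >>.
Proof.
rewrite [LHS]RGenOInfty.measurableE; apply/seteqP; split.
  apply: smallest_sub; first exact: smallest_sigma_algebra.
  move=> _ [x ->]; rewrite -[X in _ X]setCK -setTD.
  apply: sigma_algebraCD; apply: sub_sigma_algebra; exists x.
  by apply/seteqP; split => s /=; rewrite in_itv/= andbT leNgt => /negP.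
apply: smallest_sub; first exact: smallest_sigma_algebra.
move=> _ [x ->]; rewrite -[X in X _]RGenOInfty.measurableE.
rewrite [X in _ X](_ : _ = `]-oo, x]%classic); first exact: measurable_itv.
by apply/seteqP; split => s /=; rewrite in_itv.
Qed.

(** * Kernels and disintegration of a joint law *)

Section kernel_precomposition.
Context d d1 d2 (X : measurableType d) (Z : measurableType d1)
  (Y : measurableType d2) (R : realType).
Variables (K : R.-pker Z ~> Y) (f : X -> Z).

(** Carrying [mf] as an argument lets the kernel structures declared below be inferred from the
    term. *)
Definition kprecomp (mf : measurable_fun [set: X] f) (x : X) :
  {measure set Y -> \bar R} := K (f x).

Hypothesis mf : measurable_fun [set: X] f.

Let measurable_kprecomp U : measurable U ->
  measurable_fun [set: X] (kprecomp mf ^~ U).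
Proof.
by move=> mU; exact: (@measurableT_comp _ _ _ _ _ _ (K ^~ U) _ f (measurable_kernel K U mU)).
Qed.

HB.instance Definition _ :=
  isKernel.Build _ _ _ _ R (kprecomp mf) measurable_kprecomp.

Let kprecomp_prob x : kprecomp mf x [set: Y] = 1%E.
Proof. exact: prob_kernel. Qed.

HB.instance Definition _ :=
  Kernel_isProbability.Build _ _ _ _ R (kprecomp mf) kprecomp_prob.

End kernel_precomposition.

Section disintegration.
Local Open Scope ereal_scope.
Context d d1 d2 (Om : measurableType d) (Z : measurableType d1)
  (Y : measurableType d2) (R : realType).
Variables (mu : probability Om R).
Variables (K : R.-pker Z ~> Y) (f : Om -> Z) (mf : measurable_fun [set: Om] f).
Variables (h : Om -> Y) (mh : measurable_fun [set: Om] h).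

Let pairing (z : Z) (y : Y) := (z, y).
Let mpairing z : measurable_fun [set: Y] (pairing z).
Proof. exact: pair1_measurable. Qed.

(** The measure [mu] is viewed as a kernel from a point, so that kernel composition can be applied
    to it. *)
Let mu_ (_ : unit) : {measure set Om -> \bar R} := mu.

Let mu_ker U : measurable U -> measurable_fun [set: unit] (mu_ ^~ U).
Proof. by move=> _; exact: measurable_cst. Qed.

HB.instance Definition _ := isKernel.Build _ _ _ _ R mu_ mu_ker.

Let mu_prob p : mu_ p [set: _] = 1.
Proof. exact: probability_setT. Qed.

HB.instance Definition _ := Kernel_isProbability.Build _ _ _ _ R mu_ mu_prob.

(** This is the Dirac mass at [f p.2] times [K (f p.2)]. Composed with [mu_] it gives the candidate
    for the joint law of [f] and [h]. *)
Let fiber (p : unit * Om) : {measure set (Z * Y) -> \bar R}.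
refine (pushforward (K (f p.2)) (pairing (f p.2)) : {measure set (Z * Y) -> \bar R}).
exact: mpairing.
Defined.

Let fiberE p A : fiber p A = K (f p.2) (xsection A (f p.2)).
Proof. by rewrite /fiber/= /pushforward xsectionE. Qed.

Let mfiber U : measurable U -> measurable_fun [set: unit * Om] (fiber ^~ U).
Proof.
move=> mU; under eq_fun do rewrite fiberE.
apply: (@measurableT_comp _ _ _ _ _ _ (fun z => K z (xsection U z))).
  by apply: measurable_fun_xsection_finite_kernel; rewrite inE.
exact: measurableT_comp.
Qed.

HB.instance Definition _ := isKernel.Build _ _ _ _ R fiber mfiber.

Let fiber_prob p : fiber p [set: _] = 1.
Proof. by rewrite fiberE xsectionE preimage_setT prob_kernel. Qed.

HB.instance Definition _ := Kernel_isProbability.Build _ _ _ _ R fiber fiber_prob.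

Let fh w := (f w, h w).
Let mfh : measurable_fun [set: Om] fh.
Proof. exact: measurable_fun_pair. Qed.

Let joint : {measure set (Z * Y) -> \bar R}.
refine (pushforward mu fh : {measure set (Z * Y) -> \bar R}).
exact: mfh.
Defined.

(** The law of [(f, h)] and the composition of [mu_] with [fiber] agree on the pi-system [G] by
    hypothesis, hence on the sigma-algebra it generates. Integrating [phi] against both gives the
    two sides. *)
Lemma ge0_integral_disintegration (G : set (set (Z * Y))) (phi : Z * Y -> \bar R) :
  measurable `<=` <<s G >> -> G `<=` measurable -> setI_closed G ->
  (exists2 g : (set (Z * Y))^nat,
    (forall n, G (g n)) & \bigcup_n g n = [set: Z * Y]) ->
  (forall A, G A ->
    mu [set w | A (f w, h w)] = \int[mu]_w K (f w) (xsection A (f w))) ->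
  (forall p, 0 <= phi p) -> measurable_fun [set: Z * Y] phi ->
  \int[mu]_w phi (f w, h w) = \int[mu]_w \int[K (f w)]_y phi (f w, y).
Proof.
move=> sG Gm GI [g Gg gT] eqG phi0 mphi.
have eqm A : measurable A -> joint A = mkcomp mu_ fiber tt A.
  move=> mA; apply: (@g_sigma_algebra_measure_unique _ _ _ G Gm g Gg gT joint
    (mkcomp mu_ fiber tt) GI) => //.
  - by move=> B GB; rewrite [LHS](eqG _ GB); apply: eq_integral => w _;
      rewrite fiberE.
  - move=> k; rewrite /joint /= /pushforward.
    apply: (@le_lt_trans _ _ 1); last by rewrite ltry.
    by apply: probability_le1; rewrite -[X in measurable X]setTI;
      exact: (mfh measurableT (Gm _ (Gg k))).
  - exact: sG.
transitivity (\int[joint]_p phi p).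
  by rewrite (ge0_integral_pushforward mfh).
transitivity (\int[kcomp mu_ fiber tt]_p phi p).
  apply: eq_measure_integral => A mA _; exact: eqm.
rewrite integral_kcomp//; apply: eq_integral => w _.
by rewrite (ge0_integral_pushforward (mpairing (f w))).
Qed.

End disintegration.

(** * The canonical space *)

Lemma le_archi_bound (R : realType) (r : R) : r <= (Num.bound `|r|)%:R.
Proof. by rewrite (le_trans (ler_norm r))// ltW// archi_boundP. Qed.

Section ray_boxes.
Context d d1 (Z : measurableType d1) (E : measurableType d) (R : realType).

(** With [Z] the past up to stage [n], these are the events whose probability the semi-Markov kernel
    prescribes: [A] has happened, the next sojourn is at most [t], the next state lies in [B]. *)
Definition ray_box (A : set Z) (t : R) (B : set E) : set (Z * (R * E)) :=
  [set p | [/\ A p.1, p.2.1 <= t & B p.2.2]].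

Definition ray_boxes : set (set (Z * (R * E))) :=
  [set C | exists A t B, [/\ measurable A, measurable B & C = ray_box A t B]].

Lemma measurable_ray_boxes : ray_boxes `<=` measurable.
Proof.
move=> _ [A [t [B [mA mB ->]]]].
rewrite [X in measurable X](_ : _ = A `*` (`]-oo, t]%classic `*` B)).
  by apply: measurableX => //; exact: measurableX.
by apply/seteqP; split => [p []|p [? []]] /=; rewrite in_itv.
Qed.

Lemma setI_ray_boxes : setI_closed ray_boxes.
Proof.
move=> _ _ [A [t [B [mA mB ->]]]] [A' [t' [B' [mA' mB' ->]]]].
exists (A `&` A'), (Num.min t t'), (B `&` B'); split; try exact: measurableI.
apply/seteqP; split => p /=; rewrite /ray_box/= le_min.
  by move=> [[? -> ?] [? -> ?]].
by move=> [[? ?] /andP[? ?] [? ?]].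
Qed.

Lemma cover_ray_boxes : exists2 g : (set (Z * (R * E)))^nat,
  (forall n, ray_boxes (g n)) & \bigcup_n g n = setT.
Proof.
exists (fun n => ray_box setT n%:R setT).
  by move=> n; exists setT, n%:R, setT.
apply/seteqP; split => // p _.
by exists (Num.bound `|p.2.1|); [|split => //; exact: le_archi_bound].
Qed.

(** The three coordinates are measurable for the generated sigma-algebra, so the identity into the
    product is measurable too. *)
Lemma sub_measurable_ray_boxes : measurable `<=` <<s ray_boxes >>.
Proof.
pose GT := g_sigma_algebraType ray_boxes.
have box A t B : measurable A -> measurable B -> measurable (ray_box A t B : set GT).
  by move=> mA mB; apply: sub_sigma_algebra; exists A, t, B.
(* No single ray covers the line, so the time constraint is removed by a union over integer
   bounds. *)
have cyl A B : measurable A -> measurable B ->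
    measurable ([set p | A p.1 /\ B p.2.2] : set GT).
  move=> mA mB; rewrite [X in measurable X](_ : _ =
      \bigcup_n (ray_box A n%:R B : set GT)); last first.
    apply/seteqP; split => [p [Ap Bp]|p [n _ []]//].
    by exists (Num.bound `|p.2.1|); [|split => //; exact: le_archi_bound].
  by apply: bigcupT_measurable => n; exact: box.
suff mid : measurable_fun [set: GT] (idfun : GT -> Z * (R * E)).
  by move=> A mA; have := mid measurableT _ mA; rewrite setTI.
have m1 : measurable_fun [set: GT] (fun p : GT => p.1).
  move=> _ A mA; rewrite setTI; have := cyl _ _ mA (@measurableT _ E).
  by congr (measurable _); apply/seteqP; split => p //= [].
have m2 : measurable_fun [set: GT] (fun p : GT => p.2.1).
  apply: (measurability _ (measurable_rays R)) => _ [_ [t ->] <-].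
  have := box _ t _ (@measurableT _ Z) (@measurableT _ E); rewrite setTI.
  by congr (measurable _); apply/seteqP; split => p //= [].
have m3 : measurable_fun [set: GT] (fun p : GT => p.2.2).
  move=> _ A mA; rewrite setTI; have := cyl _ _ (@measurableT _ Z) mA.
  by congr (measurable _); apply/seteqP; split => p //= [].
have := measurable_fun_pair m1 (measurable_fun_pair m2 m3).
by congr (measurable_fun _ _); apply/funext => -[? []].
Qed.

Lemma measurable_ray_boxesE : measurable = <<s ray_boxes >>.
Proof.
apply/seteqP; split; first exact: sub_measurable_ray_boxes.
apply: smallest_sub; first exact: sigma_algebra_measurable.
exact: measurable_ray_boxes.
Qed.

End ray_boxes.

Section canonical_space.
Context d {E : measurableType d} {R : realType}.

(* Omega with the sigma-algebra F_n: measurability with respect to F_n becomes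
   measurability of a function on [past n]. *)
Definition past n := g_sigma_algebraType (@gen_le d E R n).

Definition mark n (w : Omega0) : R * E := (Tc n w, Xc n w).

Lemma gen_leS m n : (m <= n)%N -> @gen_le d E R m `<=` gen_le n.
Proof. by move=> mn A [k km ?]; exists k => //; exact: leq_trans mn. Qed.

Lemma filtrS m n : (m <= n)%N -> @filtr d E R m `<=` filtr n.
Proof.
move=> mn; apply: smallest_sub; first exact: smallest_sigma_algebra.
by move=> A /(gen_leS mn); exact: sub_sigma_algebra.
Qed.

Lemma measurable_filtr n (F : set (@Omega d E R)) : filtr n F -> measurable F.
Proof.
move: F; apply: smallest_sub; first exact: smallest_sigma_algebra.
by move=> A ?; apply: sub_sigma_algebra; exists n.
Qed.

Lemma measurable_Xc_past k n : (k <= n)%N ->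
  measurable_fun [set: past n] (@Xc d E R k).
Proof.
move=> kn _ B mB; rewrite setTI; apply: sub_sigma_algebra.
by exists k => //; left; exists B.
Qed.

Lemma measurable_Tc_past k n : (k <= n)%N ->
  measurable_fun [set: past n] (@Tc d E R k).
Proof.
move=> kn _ B mB; rewrite setTI; apply: sub_sigma_algebra.
by exists k => //; right; exists B.
Qed.

Lemma Sc0 (w : @Omega0 d E R) : Sc 0 w = 0.
Proof. by rewrite /Sc big_nat1. Qed.

Lemma ScS n (w : @Omega0 d E R) : Sc n.+1 w = Sc n w + Tc n.+1 w.
Proof. by rewrite /Sc big_nat_recr. Qed.

Lemma measurable_Sc_past k n : (k <= n)%N ->
  measurable_fun [set: past n] (@Sc d E R k).
Proof.
elim: k => [_|k IH kn].
  rewrite (_ : Sc 0 = cst 0); first exact: measurable_cst.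
  by apply/funext => w; exact: Sc0.
rewrite (_ : Sc k.+1 = Sc k \+ Tc k.+1); last by apply/funext => w; exact: ScS.
by apply: measurable_funD; [exact: IH (ltnW kn)|exact: measurable_Tc_past].
Qed.

Lemma measurable_past n d' (T : measurableType d') (f : past n -> T) :
  measurable_fun [set: past n] f -> measurable_fun [set: @Omega d E R] f.
Proof.
move=> mf _ A mA; have := mf measurableT A mA; rewrite !setTI.
exact: measurable_filtr.
Qed.

Lemma measurable_mark n : measurable_fun [set: @Omega d E R] (mark n).
Proof.
apply: measurable_fun_pair; apply: (@measurable_past n).
  exact: measurable_Tc_past.
exact: measurable_Xc_past.
Qed.

End canonical_space.

(** Makes the event that a path starts at [x] measurable. The singleton is the preimage of a point
    of the line under an injective measurable map. *)
Lemma borel_space_measurable_set1 d (E : measurableType d) (R : realType) (x : E) :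
  borel_space E R -> measurable [set x].
Proof.
move=> [f [mf injf _ _]].
rewrite [X in measurable X](_ : _ = f @^-1` [set f x]).
  by rewrite -[X in measurable X]setTI; exact: mf.
by apply/seteqP; split => [y ->//|y /= /injf].
Qed.

(** * The Markov property of the canonical law *)

Section canonical_law_theory.
Context d (E : measurableType d) (R : realType).
Variables (Q : R -> R.-spker E ~> E) (P : E -> probability (@Omega d E R) R).
Hypotheses (bE : borel_space E R) (smQ : semi_markov_kernel Q)
  (lawP : canonical_law Q P).
Local Open Scope ereal_scope.

Lemma measurable_start x : measurable [set w : @Omega d E R | Xc 0 w = x].
Proof.
have mX : measurable_fun [set: Omega] (@Xc d E R 0).
  exact: (measurable_past (measurable_Xc_past (leqnn 0))).
have := mX measurableT _ (borel_space_measurable_set1 x bE).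
by rewrite setTI.
Qed.

Lemma law_start x : P x [set w | Xc 0 w <> x] = 0.
Proof.
have mx := measurable_start x.
have -> : [set w | Xc 0 w <> x] = ~` [set w : @Omega d E R | Xc 0 w = x] by [].
rewrite probability_setC// (_ : [set w | Xc 0 w = x] =
  [set w | Tc 0 w = 0%R /\ Xc 0 w = x]); last first.
  by apply/seteqP; split => w /= => [->//|[]].
by rewrite (lawP x).1 subee.
Qed.

(** [Tc] is real-valued, so a generating family of rays must include negative [t], where
    [canonical_law] is silent. Such an event lies inside the one for [t = 0], which is null because
    [Q 0] vanishes. *)
Lemma law_next x n t B F : measurable B -> filtr n F ->
  P x (F `&` [set w | (Tc n.+1 w <= t)%R /\ B (Xc n.+1 w)]) =
  if (0 <= t)%R then \int[P x]_(w in F) Q t (Xc n w) B else 0.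
Proof.
move=> mB mF; case: ifPn => [t0|]; first exact: (lawP x).2.
rewrite -ltNge => t0.
have Q0 : P x (F `&` [set w | (Tc n.+1 w <= 0)%R /\ B (Xc n.+1 w)]) = 0.
  rewrite (lawP x).2//; case: smQ => _ _ Q0 _.
  by under eq_integral do rewrite Q0//; rewrite integral0.
have meas r : measurable (F `&` [set w | (Tc n.+1 w <= r)%R /\ B (Xc n.+1 w)]).
  apply: measurableI; first exact: measurable_filtr mF.
  have := @measurable_mark d E R n.+1 measurableT (`]-oo, r]%classic `*` B).
  rewrite setTI; have -> : mark n.+1 @^-1` (`]-oo, r]%classic `*` B) =
      [set w : @Omega d E R | (Tc n.+1 w <= r)%R /\ B (Xc n.+1 w)].
    by apply/seteqP; split => w /=; rewrite in_itv.
  by apply; exact: measurableX.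
apply/eqP; rewrite eq_le measure_ge0 andbT -Q0 le_measure ?inE//.
by apply: setIS => w [wt Bw]; split => //; rewrite (le_trans wt)// ltW.
Qed.

(** This is [law_next] at stage 0 with the sure event as past; the integrand is almost surely the
    constant [Q t x B] because the path starts at [x]. *)
Lemma law_first x t B : measurable B ->
  P x [set w | (Tc 1 w <= t)%R /\ B (Xc 1 w)] = if (0 <= t)%R then Q t x B else 0.
Proof.
move=> mB; rewrite -[X in P x X]setTI law_next//; last first.
  exact: (@measurableT _ (past 0)).
case: ifPn => // t0.
have mQ : measurable_fun [set: @Omega d E R] (fun w => Q t (Xc 0 w) B).
  apply: (@measurable_past _ _ _ 0).
  apply: (measurableT_comp (measurable_kernel (Q t) B mB)).
  exact: measurable_Xc_past.
rewrite (ge0_ae_eq_integral (g := cst (Q t x B)))//; last first.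
  exists [set w | Xc 0 w <> x]; split; last by move=> w /=; apply: contra_not => Xw _; rewrite Xw.
    exact: measurableC (measurable_start x).
  exact: law_start.
rewrite integral_cst//= (_ : P x _ = 1) ?mule1//.
exact: (probability_setT (P x)).
Qed.

(** [Q] is given only through distribution functions in [t]. The transition kernel to the pair
    (sojourn, next state) is read off [P] as the law of the first mark, which avoids an extension
    theorem. *)
Let first_law (x : E) : {measure set (R * E) -> \bar R}.
refine (pushforward (P x) (mark 1 : @Omega d E R -> R * E) :
  {measure set (R * E) -> \bar R}).
exact: measurable_mark.
Defined.

Let measurable_first_law U : measurable U ->
  measurable_fun [set: E] (first_law ^~ U).
Proof.
move=> mU.
(* A trivial past [unit] makes the pi-system [ray_boxes] available for the bare mark; measurability
   of [S C] is then proved by Dynkin induction on [C]. *)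
pose S (C : set (unit * (R * E))) (x : E) := P x [set w | C (tt, mark 1 w)].
have mS C : measurable C -> measurable [set w : @Omega d E R | C (tt, mark 1 w)].
  move=> mC; have := measurable_fun_pair (@measurable_cst _ _ (@Omega d E R)
    unit setT tt) (@measurable_mark d E R 1) measurableT mC.
  by rewrite setTI.
suff mSC : forall C, <<s @ray_boxes _ _ unit E R >> C -> measurable_fun [set: E] (S C).
  have := mSC (setT `*` U) (sub_measurable_ray_boxes (measurableX (@measurableT _ unit) mU)).
  congr (measurable_fun _ _); apply/funext => x; rewrite /S/= /pushforward.
  by congr (P x _); apply/seteqP; split => w //= [].
apply: (dynkin_induction (P := fun C => measurable_fun [set: E] (S C))).
- exact: measurable_ray_boxesE.
- exact: setI_ray_boxes.
- by rewrite /S/=; under eq_fun do rewrite probability_setT; exact: measurable_cst.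
- move=> _ [A [t [B [mA mB ->]]]].
  have [Att|Att] := pselect (A tt); rewrite /=; last first.
    rewrite [X in measurable_fun _ X](_ : _ = cst 0); first exact: measurable_cst.
    apply/funext => x; rewrite /S /ray_box/= [X in P x X](_ : _ = set0) ?measure0//.
    by apply/seteqP; split => w //= [].
  rewrite [X in measurable_fun _ X](_ : _ = fun x => if (0 <= t)%R then Q t x B else 0).
    by case: (0 <= t)%R; [exact: measurable_kernel|exact: measurable_cst].
  apply/funext => x; rewrite /S -law_first//; congr (P x _).
  by apply/seteqP; split => w [] //=.
- move=> C mC mSC; rewrite /=; rewrite [X in measurable_fun _ X](_ : _ = fun x => 1 - S C x).
    by apply: emeasurable_funB => //; exact: measurable_cst.
  by apply/funext => x; rewrite /S -probability_setC//; exact: mS.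
- move=> C mC tC mSC; rewrite /=.
  rewrite [X in measurable_fun _ X](_ : _ = fun x => \sum_(n <oo) S (C n) x).
    by apply: ge0_emeasurable_sum => // n x _ _; exact: measure_ge0.
  apply/funext => x; pose D n := [set w : @Omega d E R | C n (tt, mark 1 w)].
  transitivity (P x (\bigcup_n D n)).
    by congr (P x _); apply/seteqP; split => w [n _ Cn]; exists n.
  rewrite (measure_bigcup (P x) setT D)//.
  + by apply: eq_eseriesl => n; rewrite in_setT.
  + by move=> n _; exact: mS.
  + move/trivIsetP : tC => tC; apply/trivIsetP => i j _ _ ij.
    apply/seteqP; split => w //= Cw; have := tC i j Logic.I Logic.I ij.
    by move/seteqP => [+ _] => /(_ (tt, mark 1 w)); exact.
Qed.

HB.instance Definition _ := isKernel.Build _ _ _ _ R first_law measurable_first_law.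

Let first_law_prob x : first_law x [set: _] = 1.
Proof. exact: probability_setT. Qed.

HB.instance Definition _ := Kernel_isProbability.Build _ _ _ _ R first_law first_law_prob.

(* Taking the whole past [w : past n] as the first coordinate turns the defining
   property of [P x] into equality of two measures on the pi-system [ray_boxes]. *)
Lemma markov_property : exists K : R.-pker E ~> (R * E)%type,
  forall x n (phi : (past n * (R * E))%type -> \bar R),
  (forall p, 0 <= phi p) -> measurable_fun [set: past n * (R * E)] phi ->
  \int[P x]_w phi (w, mark n.+1 w) =
  \int[P x]_w \int[K (Xc n w)]_p phi (w, p).
Proof.
exists first_law => x n phi phi0 mphi.
have mX : measurable_fun [set: past n] (@Xc d E R n) by exact: measurable_Xc_past.
have mid : measurable_fun [set: @Omega d E R] (fun w => w : past n).
  by move=> _ F mF; rewrite setTI; exact: measurable_filtr mF.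
apply: (@ge0_integral_disintegration _ _ _ _ _ _ _ (P x) (kprecomp first_law mX)
  (fun w : @Omega d E R => w : past n) mid (mark n.+1) (measurable_mark n.+1)
  (@ray_boxes _ _ (past n) E R)) => //.
- exact: sub_measurable_ray_boxes.
- exact: measurable_ray_boxes.
- exact: setI_ray_boxes.
- exact: cover_ray_boxes.
- move=> _ [F [t [B [mF mB ->]]]].
  have -> : [set w : @Omega d E R | ray_box F t B (w : past n, mark n.+1 w)] =
      F `&` [set w | (Tc n.+1 w <= t)%R /\ B (Xc n.+1 w)].
    by apply/seteqP; split => w [] => [? ? ?|? []].
  rewrite law_next// integral_mkcond.
  rewrite (_ : (if _ then _ else _) = \int[P x]_(w in F) if (0 <= t)%R then Q t (Xc n w) B else 0).
    rewrite integral_mkcond; apply: eq_integral => w _; rewrite patchE.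
    (* For [w] in [F] the section of the box is the event computed by [law_first] from the start
       [Xc n w]; for other [w] the section is empty. *)
    rewrite /kprecomp /= /pushforward; case: ifPn => [|] wF.
      rewrite -law_first//; congr (P _ _); apply/seteqP; split => v /=.
        by move=> [? ?]; rewrite xsectionE/=; split => //; exact: set_mem.
      by rewrite xsectionE/= => -[].
    rewrite (_ : _ @^-1` _ = set0) ?measure0//; apply/seteqP; split => v //=.
    by rewrite xsectionE/= => -[+ _ _] => /mem_set; rewrite (negbTE wF).
  by rewrite -integral_mkcond; case: ifP => // _; rewrite integral0.
Qed.

End canonical_law_theory.

(** * Non-explosion *)

Section regular_paths.
Context d {E : measurableType d} {R : realType}.

Definition regular_path (w : @Omega0 d E R) :=
  (forall k, 0 < Tc k.+1 w) /\ (forall s, exists m, s <= Sc m w).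

Lemma regular_Sc_homo (w : @Omega0 d E R) m n :
  (forall k, 0 < Tc k.+1 w) -> (m <= n)%N -> Sc m w <= Sc n w.
Proof.
move=> T0 mn; rewrite -(subnKC mn); elim: (n - m)%N => [|j IH].
  by rewrite addn0.
by rewrite addnS ScS (le_trans IH)// lerDl ltW.
Qed.

Lemma regular_Sc_ge0 (w : @Omega0 d E R) n :
  (forall k, 0 < Tc k.+1 w) -> 0 <= Sc n w.
Proof. by move=> T0; rewrite -(Sc0 w); exact: regular_Sc_homo. Qed.

(** Infinitely many sojourns exceed [delta] and the others are positive, so [Sc] passes every
    multiple of [delta]. *)
Lemma regular_pathP (w : @Omega0 d E R) (delta : R) :
  0 < delta -> (forall k, 0 < Tc k.+1 w) ->
  (forall n, exists j, delta < Tc (n + j).+1 w) -> regular_path w.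
Proof.
move=> d0 T0 Td; split => // s.
have step q : exists m, q%:R * delta <= Sc m w.
  elim: q => [|q [m qm]]; first by exists 0%N; rewrite mul0r Sc0.
  have [j dj] := Td m; exists (m + j).+1.
  rewrite ScS -natr1 mulrDl mul1r lerD// ?(ltW dj)//.
  by rewrite (le_trans qm)//; apply: regular_Sc_homo => //; exact: leq_addr.
have [m qm] := step (Num.bound `|s / delta|); exists m.
by rewrite (le_trans _ qm)// -ler_pdivrMr// le_archi_bound.
Qed.

Variables (Q : R -> R.-spker E ~> E) (P : E -> probability (@Omega d E R) R).
Hypotheses (smQ : semi_markov_kernel Q) (lawP : canonical_law Q P).
Local Open Scope ereal_scope.

Let measurable_Tle k t : measurable [set w : @Omega d E R | (Tc k w <= t)%R].
Proof.
have mT : measurable_fun [set: @Omega d E R] (Tc k).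
  exact: (measurable_past (measurable_Tc_past (leqnn k))).
have := mT measurableT `]-oo, t]%classic (measurable_itv _); rewrite setTI.
by congr (measurable _); apply/seteqP; split => w /=; rewrite in_itv.
Qed.

Let short (delta : R) n m : set (@Omega d E R) :=
  [set w | forall j, (j < m)%N -> (Tc (n + j).+1 w <= delta)%R].

Let shortS delta n m : short delta n m.+1 =
  short delta n m `&` [set w | (Tc (n + m).+1 w <= delta)%R /\ setT (Xc (n + m).+1 w)].
Proof.
apply/seteqP; split => w /= H; first by split=> [j jm|]; [exact/H/ltnW|split=> //; exact: H].
by move=> j; rewrite ltnS leq_eqVlt => /predU1P[->|jm]; [exact: H.2.1|exact: H.1].
Qed.

Let filtr_short delta n m : filtr (n + m) (short delta n m).
Proof.
elim: m => [|m IH].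
  have -> : short delta n 0 = setT by apply/seteqP; split.
  exact: (@measurableT _ (past (n + 0))).
rewrite shortS; apply: (@measurableI _ (past (n + m.+1))).
  by apply: filtrS IH; rewrite leq_add2l.
have := @measurable_Tc_past d E R _ _ (leqnn (n + m.+1)) measurableT
  `]-oo, delta]%classic (measurable_itv _).
rewrite setTI addnS; congr (measurable _).
by apply/seteqP; split => w /=; rewrite in_itv/= => // -[].
Qed.

(** Conditionally on the past, each further sojourn is short with probability at most [r], so every
    stage contributes a factor [r]. *)
Let prob_short (delta r : R) x n m : (0 <= delta)%R -> (0 <= r)%R ->
  (forall y, Q delta y setT <= r%:E) -> P x (short delta n m) <= (r ^+ m)%:E.
Proof.
move=> d0 r0 Qr.
have mS k : measurable (short delta n k).
  exact: measurable_filtr (@filtr_short delta n k).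
elim: m => [|m IH]; first by rewrite expr0; exact: probability_le1.
rewrite shortS (lawP x).2//.
rewrite (@le_trans _ _ (\int[P x]_(w in short delta n m) cst r%:E w))//.
  apply: ge0_le_integral => //.
  apply: measurable_funTS; apply: (@measurable_past _ _ _ (n + m)).
  apply: (measurableT_comp (measurable_kernel (Q delta) setT measurableT)).
  exact: measurable_Xc_past.
rewrite integral_cst//= exprS EFinM; apply: lee_wpmul2l => //.
Qed.

Let short_null (delta r : R) x n : (0 <= delta)%R -> (0 <= r < 1)%R ->
  (forall y, Q delta y setT <= r%:E) -> P x (\bigcap_m short delta n m) = 0.
Proof.
move=> d0 /andP[r0 r1] Qr; apply/eqP; rewrite eq_le measure_ge0 andbT.
have mS m : measurable (short delta n m) := measurable_filtr (@filtr_short delta n m).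
apply/lee_addgt0Pr => e e0; rewrite add0e.
have : (r ^+ m)%R @[m --> \oo] --> (0 : R)%R by apply: cvg_expr; rewrite ger0_norm.
move=> /cvgrPdist_lt/(_ e e0)[m _ /(_ m (leqnn m))].
rewrite /= sub0r normrN ger0_norm ?exprn_ge0// => /ltW rme.
apply: (@le_trans _ _ (P x (short delta n m))); last first.
  by rewrite (le_trans (prob_short x n m d0 r0 Qr))// lee_fin.
rewrite le_measure ?inE//; first exact: bigcapT_measurable.
by move=> w /(_ m Logic.I).
Qed.

Lemma almost_all_paths_regular :
  (exists delta eps : R, [/\ (0 < delta)%R, (0 < eps)%R &
     forall x : E, Q delta x setT <= (1 - eps)%:E]) ->
  exists N : set (@Omega d E R), [/\ measurable N, (forall x, P x N = 0) &
    forall w, ~ N w -> regular_path w].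
Proof.
move=> [delta [eps [d0 e0 Qd]]].
(* [N1] is null because [Q 0] vanishes. [N2] holds the paths whose sojourns are all at most [delta]
   from some index on. Neither set depends on [x], so one exceptional set serves all starting
   points. *)
pose N1 := \bigcup_k [set w : @Omega d E R | (Tc k.+1 w <= 0)%R].
pose N2 := \bigcup_n \bigcap_m short delta n m.
have mN1 : measurable N1 by apply: bigcupT_measurable => k; exact: measurable_Tle.
have mN2 n : measurable (\bigcap_m short delta n m).
  apply: bigcapT_measurable => m.
  exact: measurable_filtr (@filtr_short delta n m).
exists (N1 `|` N2); split.
- by apply: measurableU => //; exact: bigcupT_measurable.
- move=> x.
  have null (F : (set (@Omega d E R))^nat) : (forall k, measurable (F k)) ->
      (forall k, P x (F k) = 0) ->
      P x (\bigcup_k F k) = 0.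
    move=> mF F0; apply/eqP; rewrite eq_le measure_ge0 andbT.
    rewrite (le_trans (le_mu_bigcup (P x) mF _))//; first exact: bigcupT_measurable.
    by rewrite eseries0 // => k _ _; exact: F0.
  have N20 : P x N2 = 0.
    apply: null => // n; apply: (@short_null _ (1 - eps)%R) => //; first exact: ltW.
    (* [1 - eps] is nonnegative because it bounds a mass of [Q delta x]. *)
    by rewrite ltrBlDr ltrDl e0 andbT -lee_fin (le_trans _ (Qd x)).
  rewrite measureU0 //; last exact: bigcupT_measurable.
  apply: null => // k; case: smQ => _ _ Q0 _.
  rewrite (_ : [set _ | _] = setT `&` [set w : @Omega d E R |
    (Tc k.+1 w <= 0)%R /\ setT (Xc k.+1 w)]); last first.
    by apply/seteqP; split => w //= [_ []].
  rewrite (lawP x).2//; last exact: (@measurableT _ (past k)).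
  by under eq_integral do rewrite Q0//; rewrite integral0.
- move=> w /not_orP[nN1 nN2]; apply: (regular_pathP d0).
    move=> k; rewrite ltNge; apply/negP => Tk; apply: nN1.
    by exists k.
  move=> n; apply: contrapT => /forallNP nj; apply: nN2; exists n => // m _ j _.
  by rewrite leNgt; apply/negP/nj.
Qed.

End regular_paths.

(** * The reward along a path *)

Section pathwise_reward.
Context d {E : measurableType d} {R : realType}.
Implicit Types (w : @Omega0 d E R) (c g : E -> R) (s u : R).

(** The time spent in the state of stage [k] before the horizon [s]; the outer maximum gives 0 to
    stages that begin after [s]. *)
Definition holding s k w : R := Num.max 0 (Num.min (Tc k.+1 w) (s - Sc k w)).

Lemma holding_ge0 s k w : 0 <= holding s k w.
Proof. by rewrite /holding le_max lexx. Qed.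

Lemma holding_full s k w : 0 < Tc k.+1 w -> Sc k.+1 w <= s ->
  holding s k w = Tc k.+1 w.
Proof.
move=> T0; rewrite ScS -lerBrDl => Ts.
by rewrite /holding min_l// max_r// ltW.
Qed.

Lemma holding_past s k w : s <= Sc k w -> holding s k w = 0.
Proof.
by rewrite -subr_le0 => sS; rewrite /holding max_l// ge_min sS orbT.
Qed.

Lemma regular_Xproc w t m : (forall k, 0 < Tc k.+1 w) ->
  Sc m w <= t < Sc m.+1 w -> Xproc w t = Xc m w.
Proof.
move=> T0 tm; rewrite /Xproc (xget_unique _ (x := m))// => n /= /andP[nt tn].
move: tm => /andP[mt tm]; apply/eqP; rewrite eqn_leq.
apply/andP; split; rewrite leqNgt; apply/negP => h.
- by have := le_lt_trans nt tm; rewrite ltNge regular_Sc_homo.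
- by have := le_lt_trans mt tn; rewrite ltNge regular_Sc_homo.
Qed.

(** The interval from 0 to [u] is cut at the jump times. On each piece [J n] the process is
    constant, and the length of that piece is [holding u n w]. *)
Lemma run_cost_regular c w u m : (forall x, 0 <= c x) ->
  (forall k, 0 < Tc k.+1 w) -> u <= Sc m w ->
  run_cost c w u%:E = (\sum_(0 <= k < m) c (Xc k w) * holding u k w)%:E.
Proof.
move=> c0 T0 um.
pose D n := [set t : R | 0 <= t < u /\ t < Sc n w].
pose J n := [set` `[Sc n w, Num.min u (Sc n.+1 w)[ : interval R].
pose f t := (c (Xproc w t))%:E.
have XJ n : {in J n, f =1 cst (c (Xc n w))%:E}.
  move=> t; rewrite inE /J/= in_itv/= lt_min => /andP[nt /andP[_ tn]].
  by rewrite /f (@regular_Xproc w t n)// nt tn.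
have DS n : D n.+1 = D n `|` J n.
  apply/seteqP; split => t; rewrite /D /J/= in_itv/= lt_min.
    move=> [/andP[t0 tu] tn]; have [tSn|tSn] := ltP t (Sc n w).
      by left; rewrite t0 tu.
    by right; rewrite tu tn.
  move=> [[/andP[-> ->] tn]|/andP[nt /andP[-> ->]]].
    by split => //; rewrite (lt_le_trans tn)// regular_Sc_homo.
  by split => //; rewrite andbT (le_trans _ nt)// regular_Sc_ge0.
have step n : [/\ measurable (D n), measurable_fun (D n) f &
    (\int[lebesgue_measure]_(t in D n) f t)%E =
    (\sum_(0 <= k < n) c (Xc k w) * holding u k w)%:E].
  elim: n => [|n [mD mf IH]].
    have -> : D 0 = set0.
      apply/seteqP; split => t //=; rewrite /D/= Sc0 => -[/andP[t0 _]].
      by rewrite ltNge t0.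
    by split; [by []|exact: measurable_fun_set0|rewrite integral_set0 big_geq].
  have mJ : measurable (J n) by exact: measurable_itv.
  have mfJ : measurable_fun (J n) f.
    by apply: (eq_measurable_fun (cst (c (Xc n w))%:E)) => // t /XJ.
  rewrite DS; split; first exact: measurableU.
    by apply/measurable_funU.
  rewrite ge0_integral_setU//; last 3 first.
  - by apply/measurable_funU.
  - by move=> t _; rewrite lee_fin.
  - rewrite disj_set2E; apply/eqP/seteqP; split => t //=.
    rewrite /D /J/= in_itv/= => -[[_ tn] /andP[nt _]].
    by move: tn; rewrite ltNge nt.
  rewrite IH big_nat_recr//= EFinD; congr (_ + _)%E.
  transitivity (\int[lebesgue_measure]_(t in J n) cst (c (Xc n w))%:E t)%E.
    by apply: eq_integral; exact: XJ.
  rewrite integral_cst// EFinM; congr (_ * _)%E.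
  rewrite /J /= lebesgue_measure_itv/= lte_fin lt_min /holding ScS.
  have -> : Num.min (Tc n.+1 w) (u - Sc n w) = Num.min u (Sc n w + Tc n.+1 w) - Sc n w.
    by rewrite addr_minl (addrC (Sc n w)) addrK minC.
  rewrite ltrDl T0 andbT.
  case: ifPn => h; first by rewrite -EFinB max_r// subr_ge0 le_min (ltW h) lerDl ltW.
  by rewrite max_l// subr_le0 ge_min leNgt h.
have [_ _ <-] := step m; rewrite /run_cost; congr (integral _ _ _).
apply/seteqP; split => t /=; rewrite /D/= lte_fin.
  by move=> [-> tu]; rewrite tu (lt_le_trans tu).
by move=> [/andP[-> ->]].
Qed.

Definition alive (tau : @Omega d E R -> option nat) k w :=
  if tau w is Some n then (k <= n)%N else true.

(** The guard [alive tau k.+1] means that [tau] exceeds [k], an event decided by the past up to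
    stage [k]. Only the holding time then looks one jump ahead. *)
Definition stage_cost c g (tau : @Omega d E R -> option nat) s k w : R :=
  if tau w == Some k then (if Sc k w < s then g (Xc k w) else 0)
  else if alive tau k.+1 w then c (Xc k w) * holding s k w else 0.

Lemma stage_cost_ge0 c g tau s k w :
  (forall x, 0 <= c x) -> (forall x, 0 <= g x) -> 0 <= stage_cost c g tau s k w.
Proof.
move=> c0 g0; rewrite /stage_cost; do 2 case: ifP => // _.
by rewrite mulr_ge0// holding_ge0.
Qed.

Lemma eseries_truncate (f : nat -> \bar R) m : (forall k, 0 <= f k)%E ->
  (forall k, (m <= k)%N -> f k = 0%E) ->
  (\sum_(k <oo) f k = \sum_(0 <= k < m) f k)%E.
Proof.
move=> f0 fm; rewrite (nneseries_split 0 m)//= add0n.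
by rewrite [X in (_ + X)%E]eseries0 ?adde0// => k mk _; exact: fm.
Qed.

Lemma reward_regular c g tau s w : (forall x, 0 <= c x) -> (forall x, 0 <= g x) ->
  regular_path w ->
  reward c g tau s w = (\sum_(k <oo) (stage_cost c g tau s k w)%:E)%E.
Proof.
move=> c0 g0 [T0 Soo]; rewrite /reward.
have st0 k : (0 <= (stage_cost c g tau s k w)%:E)%E.
  by rewrite lee_fin stage_cost_ge0.
case tauE : (tau w) => [n|]; last first.
  (* Without stopping, [Stau] is the limit of [Sc], hence at least [s]: only the running cost up to
     [s] is paid, and stages from [m] on have zero holding time. *)
  have [m sm] := Soo s.
  rewrite /Stau tauE ifF; last first.
    apply/negbTE; rewrite -leNgt; apply: lime_ge.
      apply: ereal_nondecreasing_is_cvgn => i j ij.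
      by rewrite lee_fin regular_Sc_homo.
    near=> j; rewrite lee_fin (le_trans sm)// regular_Sc_homo//.
    by near: j; exact: nbhs_infty_ge.
  rewrite (@run_cost_regular c w s m)// (eseries_truncate (m := m))//; last first.
    move=> k mk; rewrite /stage_cost tauE /= /alive tauE holding_past ?mulr0//.
    by rewrite (le_trans sm)// regular_Sc_homo.
  rewrite -sumEFin; apply: eq_bigr => k _.
  by rewrite /stage_cost tauE /= /alive tauE.
rewrite /Stau tauE lte_fin (eseries_truncate (m := n.+1))//; last first.
  move=> k nk; rewrite /stage_cost /alive tauE.
  rewrite ifF; last by apply/eqP => -[nkE]; move: nk; rewrite nkE ltnn.
  by rewrite leqNgt (ltn_trans nk).
rewrite big_nat_recr//= {2}/stage_cost tauE eqxx.
have early k : (k < n)%N ->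
    stage_cost c g tau s k w = c (Xc k w) * holding s k w.
  move=> kn; rewrite /stage_cost /alive tauE kn ifF//.
  by apply/eqP => -[nk]; move: kn; rewrite nk ltnn.
(* If stopping precedes the horizon, all earlier stages are complete, so truncation at [s] or at
   [Sc n w] gives the same holding times; moreover [Xproc] at [Sc n w] is [Xc n w], as the next
   sojourn is positive. *)
case: ifPn => [Sns|nSns].
  rewrite (@run_cost_regular c w (Sc n w) n)//.
  congr (_ + _)%E; last by rewrite (@regular_Xproc w _ n)// lexx ScS ltrDl T0.
  rewrite -sumEFin; apply: eq_big_nat => k /= kn.
  by rewrite early// !holding_full// ?regular_Sc_homo// (le_trans _ (ltW Sns))// regular_Sc_homo.
rewrite adde0 (@run_cost_regular c w s n)//; last by rewrite leNgt.
by rewrite -sumEFin; apply: eq_big_nat => k /= kn; rewrite early.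
Unshelve. all: by end_near. Qed.

End pathwise_reward.

(** * Value iteration *)

Section value_iteration.
Context d (E : measurableType d) (R : realType).
Variables (K : R.-pker E ~> (R * E)%type) (c g : E -> R).
Hypotheses (mc : measurable_fun [set: E] c) (c0 : forall x, 0 <= c x).
Hypotheses (mg : measurable_fun [set: E] g) (g0 : forall x, 0 <= g x).
Local Open Scope ereal_scope.

(** Here [p] is (remaining horizon, current state) and [q] is (sojourn, next state). *)
Definition step_cost (v : R * E -> \bar R) (p q : R * E) : \bar R :=
  (c p.2 * Num.max 0 (Num.min q.1 p.1))%:E + v (p.1 - q.1, q.2)%R.

Definition one_step v (p : R * E) : \bar R := \int[K p.2]_q step_cost v p q.

Fixpoint value n (p : R * E) : \bar R :=
  if n is m.+1 then
    if (0 < p.1)%R then mine (g p.2)%:E (one_step (value m) p) else 0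
  else 0.

Definition value_lim p := limn (value ^~ p).

Lemma step_cost_ge0 v p q : (forall p, 0 <= v p) -> 0 <= step_cost v p q.
Proof. by move=> v0; rewrite adde_ge0// lee_fin mulr_ge0// le_max lexx. Qed.

Lemma measurable_step_cost v : measurable_fun [set: R * E] v ->
  measurable_fun [set: (R * E) * (R * E)] (fun pq => step_cost v pq.1 pq.2).
Proof.
move=> mv; apply: emeasurable_funD.
  apply/measurable_EFinP; apply: measurable_funM.
    by apply: (measurableT_comp mc); exact: measurableT_comp.
  apply: measurable_maxr => //; apply: measurable_minr; exact: measurableT_comp.
apply: (measurableT_comp mv); apply: measurable_fun_pair.
  by apply: measurable_funB; exact: measurableT_comp.
exact: measurableT_comp.
Qed.

Lemma measurable_step_cost2 v p : measurable_fun [set: R * E] v ->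
  measurable_fun [set: R * E] (step_cost v p).
Proof. by move=> mv; exact: measurable_fun_pair2 (measurable_step_cost mv). Qed.

Lemma measurable_one_step v : measurable_fun [set: R * E] v ->
  (forall p, 0 <= v p) -> measurable_fun [set: R * E] (one_step v).
Proof.
move=> mv v0.
apply: (measurable_fun_integral_finite_kernel
  (fun pq => step_cost v pq.1 pq.2) (kprecomp K measurable_snd)).
  by move=> z; exact: step_cost_ge0.
exact: measurable_step_cost.
Qed.

Lemma one_step_ge0 v p : (forall p, 0 <= v p) -> 0 <= one_step v p.
Proof. by move=> v0; apply: integral_ge0 => q _; exact: step_cost_ge0. Qed.

Lemma le_one_step v v' p : measurable_fun [set: R * E] v ->
  measurable_fun [set: R * E] v' -> (forall p, 0 <= v p) ->
  (forall p, v p <= v' p) -> one_step v p <= one_step v' p.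
Proof.
move=> mv mv' v0 vv'; apply: ge0_le_integral => //.
- by move=> q _; exact: step_cost_ge0.
- exact: measurable_step_cost2.
- exact: measurable_step_cost2.
- by move=> q _; rewrite leeD2l.
Qed.

Lemma value_ge0 n p : 0 <= value n p.
Proof.
elim: n p => //= n IH p; case: ifP => // _.
by rewrite le_min lee_fin g0 one_step_ge0.
Qed.

Lemma measurable_value n : measurable_fun [set: R * E] (value n).
Proof.
elim: n => [|n IH] /=; first exact: measurable_cst.
apply: measurable_fun_ifT => //; last first.
  apply: measurable_mine.
    by apply/measurable_EFinP; exact: measurableT_comp.
  by apply: measurable_one_step => // p; exact: value_ge0.
exact: measurable_fun_ltr.
Qed.

Lemma valueS n p : value n p <= value n.+1 p.
Proof.
elim: n p => [|n IH] p; first exact: (value_ge0 1).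
rewrite [leLHS]/= [leRHS]/=; case: ifP => // _.
rewrite le_min ge_min lexx ge_min le_one_step ?orbT//.
- exact: measurable_value.
- exact: (measurable_value n.+1).
- exact: value_ge0.
Qed.

Lemma value_nd p : nondecreasing_seq (value ^~ p).
Proof. by apply/nondecreasing_seqP => n; exact: valueS. Qed.

Lemma value_cvg p : value n p @[n --> \oo] --> value_lim p.
Proof. by apply: ereal_nondecreasing_is_cvgn; exact: value_nd. Qed.

Lemma value_le_lim n p : value n p <= value_lim p.
Proof.
apply: lime_ge; first exact: value_cvg.
by near=> m; apply: value_nd; near: m; exact: nbhs_infty_ge.
Unshelve. all: by end_near. Qed.

Lemma value_lim_ge0 p : 0 <= value_lim p.
Proof. exact: le_trans (value_ge0 0 p) (value_le_lim 0 p). Qed.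

Lemma measurable_value_lim : measurable_fun [set: R * E] value_lim.
Proof.
apply: (emeasurable_fun_cvg value) => [n|p _]; first exact: measurable_value.
exact: value_cvg.
Qed.

Lemma value_lim_le u p : (forall n, value n p <= u) -> value_lim p <= u.
Proof.
move=> vu; rewrite /value_lim; apply: lime_le; first exact: value_cvg.
by apply: nearW.
Qed.

Lemma value_le_terminal n p : (0 < p.1)%R -> value n p <= (g p.2)%:E.
Proof.
by case: n => [|n] /= p0; [rewrite lee_fin|rewrite p0 ge_min lexx].
Qed.

Lemma value_lim_le_terminal p : (0 < p.1)%R -> value_lim p <= (g p.2)%:E.
Proof. by move=> p0; apply: value_lim_le => n; exact: value_le_terminal. Qed.

Lemma one_step_value_lim p :
  one_step value_lim p = limn (fun n => one_step (value n) p).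
Proof.
rewrite /one_step -monotone_convergence//.
- apply: eq_integral => q _; apply/esym/cvg_lim => //; apply: cvgeD => //.
  + exact: cvg_cst.
  + exact: value_cvg.
- by move=> n; apply: measurable_step_cost2; exact: measurable_value.
- by move=> n q _; apply: step_cost_ge0; exact: value_ge0.
- by move=> q _ m n mn; rewrite leeD2l//; exact: value_nd.
Qed.

(** Every iterate stays below a limit that is strictly less than [g], so its minimum is never
    attained by [g] and must come from [one_step]. Monotone convergence passes this to the limit. *)
Lemma value_lim_continuation p : (0 < p.1)%R -> value_lim p != (g p.2)%:E ->
  one_step value_lim p <= value_lim p.
Proof.
move=> p0 vg; have {}vg : value_lim p < (g p.2)%:E.
  by rewrite lt_neqAle vg value_lim_le_terminal.
rewrite one_step_value_lim; apply: lime_le.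
  apply: ereal_nondecreasing_is_cvgn => m n mn; apply: le_one_step.
  - exact: measurable_value.
  - exact: measurable_value.
  - exact: value_ge0.
  - by move=> q; exact: value_nd.
apply: nearW => n; have := value_le_lim n.+1 p; rewrite /= p0 ge_min.
by rewrite leNgt vg.
Qed.

End value_iteration.

(** * Stopping times *)

Section first_hit_theory.
Implicit Types p q : nat -> Prop.

Lemma first_hit_SomeP p n :
  first_hit p = Some n <-> p n /\ (forall k, (k < n)%N -> ~ p k).
Proof.
rewrite /first_hit; case: pselect => [[m pm]|np]; last first.
  by split => // -[pn _]; exfalso; apply: np; exists n.
case: ex_minnP => k /asboolP pk kmin; split.
  move=> [<-]; split => // j jk /asboolP pj.
  by move: jk; rewrite ltnNge kmin.
move=> [/asboolP pn nmin]; congr Some; apply/eqP; rewrite eqn_leq kmin//= leqNgt.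
by apply/negP => /nmin.
Qed.

Lemma first_hit_NoneP p : first_hit p = None <-> forall n, ~ p n.
Proof.
rewrite /first_hit; case: pselect => [[m pm]|np].
  by split => // /(_ m).
by split => // _ n pn; apply: np; exists n.
Qed.

(** Merges the two infima defining [tau_star] into the hitting time of a single set. *)
Lemma omin_first_hit p q : omin (first_hit p) (first_hit q) = first_hit (fun n => p n \/ q n).
Proof.
apply/esym; case pE : (first_hit p) => [m|]; case qE : (first_hit q) => [n|] /=.
- move/first_hit_SomeP : pE => [pm minp]; move/first_hit_SomeP : qE => [qn minq].
  apply/first_hit_SomeP; split.
    by rewrite /minn; case: ltnP => _; [left|right].
  by move=> k; rewrite leq_min => /andP[km kn] []; [exact: minp|exact: minq].
- move/first_hit_SomeP : pE => [pm minp]; move/first_hit_NoneP : qE => nq.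
  by apply/first_hit_SomeP; split; [left|move=> k km [pk|/nq//]; exact: minp pk].
- move/first_hit_NoneP : pE => np; move/first_hit_SomeP : qE => [qn minq].
  by apply/first_hit_SomeP; split; [right|move=> k km [/np//|qk]; exact: minq qk].
- move/first_hit_NoneP : pE => np; move/first_hit_NoneP : qE => nq.
  by apply/first_hit_NoneP => k [/np|/nq].
Qed.

End first_hit_theory.

Section stopping_times.
Context d {E : measurableType d} {R : realType}.

Lemma stopping_time_first_hit (H : set (R * E)) (s : R) : measurable H ->
  stopping_time (fun w : @Omega d E R => first_hit (fun n => H (s - Sc n w, Xc n w))).
Proof.
move=> mH n.
have mhit k : (k <= n)%N -> measurable ([set w | H (s - Sc k w, Xc k w)] : set (@past d E R n)).
  move=> kn; have mS : measurable_fun [set: @past d E R n] (fun w => s - Sc k w).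
    exact: (measurable_funB (@measurable_cst _ _ _ _ setT s) (measurable_Sc_past kn)).
  have := measurable_fun_pair mS (measurable_Xc_past kn) measurableT mH.
  by rewrite setTI.
suff -> : [set w : @Omega d E R | first_hit (fun n => H (s - Sc n w, Xc n w)) = Some n] =
    [set w | H (s - Sc n w, Xc n w)] `&`
    \bigcap_(k in [set k | (k < n)%N]) ~` [set w | H (s - Sc k w, Xc k w)].
  apply: (@measurableI _ (@past d E R n)); first exact: mhit.
  apply: (@bigcap_measurableType _ (@past d E R n)) => k /= kn.
  by apply: (@measurableC _ (@past d E R n)); apply: mhit; exact: ltnW.
apply/seteqP; split => w /=.
  by move/first_hit_SomeP => [Hn Hk]; split => // k /= /Hk.
by move=> [Hn Hk]; apply/first_hit_SomeP; split => // k kn; exact: Hk.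
Qed.

Variable tau : @Omega d E R -> option nat.
Hypothesis tauP : stopping_time tau.

Lemma measurable_stopped k : measurable_fun [set: @past d E R k] (fun w => tau w == Some k).
Proof.
apply: (measurable_fun_bool true); rewrite setTI; have := @tauP k.
by congr (filtr _ _); apply/seteqP; split => w /= /eqP.
Qed.

Lemma measurable_alive k : measurable_fun [set: @past d E R k] (alive tau k.+1).
Proof.
apply: (measurable_fun_bool false); rewrite setTI.
suff -> : alive tau k.+1 @^-1` [set false] =
    \bigcup_(i in [set i | (i <= k)%N]) [set w | tau w = Some i].
  apply: (@bigcup_measurable _ (@past d E R k)) => i /= ik.
  exact: filtrS ik _ (@tauP i).
apply/seteqP; split => w /=; rewrite /alive.
  case tauw : (tau w) => [n|//] /negbT; rewrite -ltnNge ltnS => nk.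
  by exists n.
by move=> [i /= ik ->]; apply/negbTE; rewrite -leqNgt.
Qed.

Lemma measurable_None : measurable [set w | tau w = None].
Proof.
rewrite [X in measurable X](_ : _ = ~` \bigcup_n [set w | tau w = Some n]).
  apply: measurableC; apply: bigcupT_measurable => n.
  exact: measurable_filtr (@tauP n).
apply/seteqP; split => w /=; first by move=> wN [n _] /=; rewrite wN.
by case tauw : (tau w) => [n|//] nw; exfalso; apply: nw; exists n.
Qed.

End stopping_times.

(** * Optimality *)

Section optimality.
Context d (E : measurableType d) (R : realType).
Variables (P : E -> probability (@Omega d E R) R).
Variables (K : R.-pker E ~> (R * E)%type) (c g : E -> R).
Hypotheses (mc : measurable_fun [set: E] c) (c0 : forall x, 0 <= c x).
Hypotheses (mg : measurable_fun [set: E] g) (g0 : forall x, 0 <= g x).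
Hypothesis markov : forall x n (phi : (@past d E R n * (R * E))%type -> \bar R),
  (forall p, 0 <= phi p)%E -> measurable_fun setT phi ->
  (\int[P x]_w phi (w, mark n.+1 w) =
   \int[P x]_w \int[K (Xc n w)]_p phi (w, p))%E.
Hypotheses (mstart : forall x, measurable [set w : @Omega d E R | Xc 0 w = x])
  (startP : forall x, P x [set w | Xc 0 w <> x] = 0%E).
Variable N : set (@Omega d E R).
Hypotheses (mN : measurable N) (N0 : forall x, P x N = 0%E)
  (regN : forall w, ~ N w -> regular_path w).
Local Open Scope ereal_scope.

Notation value := (value K c g).
Notation value_lim := (value_lim K c g).
Notation one_step := (one_step K c).

Definition state s k (w : @Omega0 d E R) : R * E := (s - Sc k w, Xc k w)%R.

Lemma measurable_state_past s k n : (k <= n)%N ->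
  measurable_fun [set: @past d E R n] (state s k).
Proof.
move=> kn; apply: measurable_fun_pair; last exact: measurable_Xc_past.
exact: (measurable_funB (@measurable_cst _ _ _ _ setT s) (measurable_Sc_past kn)).
Qed.

Lemma measurable_state s k : measurable_fun [set: @Omega d E R] (state s k).
Proof. exact: measurable_past (measurable_state_past s (leqnn k)). Qed.

(** * Costs and continuation values stage by stage *)

Section one_stage.
Variables (tau : @Omega d E R -> option nat) (s : R).
Hypothesis tauP : stopping_time tau.

(** The stage cost is split into this part, known at jump [k], and [running_cost], which involves
    the next sojourn and is averaged by the Markov property. *)
Definition halting_cost k w : \bar R :=
  if tau w == Some k then (if (Sc k w < s)%R then (g (Xc k w))%:E else 0) else 0.

Definition running_cost k w : \bar R :=
  if alive tau k.+1 w then (c (Xc k w) * holding s k w)%:E else 0.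

Definition continuing k (v : R * E -> \bar R) w : \bar R :=
  if alive tau k w then v (state s k w) else 0.

Lemma stage_costE k w :
  (stage_cost c g tau s k w)%:E = halting_cost k w + running_cost k w.
Proof.
rewrite /stage_cost /halting_cost /running_cost.
case: eqP => [tauk|_]; last by case: ifP; rewrite add0e.
by rewrite /alive tauk ltnn adde0; case: ifP.
Qed.

Lemma halting_cost_ge0 k w : 0 <= halting_cost k w.
Proof. by rewrite /halting_cost; do 2 case: ifP => // _; rewrite lee_fin. Qed.

Lemma running_cost_ge0 k w : 0 <= running_cost k w.
Proof.
by rewrite /running_cost; case: ifP => // _; rewrite lee_fin mulr_ge0// holding_ge0.
Qed.

Lemma continuing_ge0 k v w : (forall p, 0 <= v p) -> 0 <= continuing k v w.
Proof. by move=> v0; rewrite /continuing; case: ifP. Qed.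

Lemma measurable_halting_cost k : measurable_fun [set: @Omega d E R] (halting_cost k).
Proof.
apply: (@measurable_past _ _ _ k); apply: measurable_fun_ifT.
- exact: measurable_stopped.
- apply: measurable_fun_ifT.
  + exact: (measurable_fun_ltr (measurable_Sc_past (leqnn k)) (@measurable_cst _ _ _ _ setT s)).
  + apply/measurable_EFinP.
    exact: (measurableT_comp mg (measurable_Xc_past (leqnn k))).
  + exact: measurable_cst.
- exact: measurable_cst.
Qed.

Lemma measurable_running_cost k : measurable_fun [set: @Omega d E R] (running_cost k).
Proof.
apply: measurable_fun_ifT.
- by apply: (@measurable_past _ _ _ k); exact: measurable_alive.
- apply/measurable_EFinP; apply: measurable_funM.
    apply: (@measurable_past _ _ _ k).
    exact: (measurableT_comp mc (measurable_Xc_past (leqnn k))).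
  apply: (@measurable_past _ _ _ k.+1).
  apply: measurable_maxr; first exact: measurable_cst.
  apply: measurable_minr; first exact: (measurable_Tc_past (leqnn k.+1)).
  exact: (measurable_funB (@measurable_cst _ _ _ _ setT s) (measurable_Sc_past (leqnSn k))).
- exact: measurable_cst.
Qed.

Lemma measurable_aliveT k : measurable_fun [set: @Omega d E R] (alive tau k).
Proof.
case: k => [|k]; last by apply: (@measurable_past _ _ _ k); exact: measurable_alive.
rewrite (_ : alive tau 0 = cst true); first exact: measurable_cst.
by apply/funext => w; rewrite /alive; case: (tau w).
Qed.

Lemma measurable_continuing k v : measurable_fun [set: R * E] v ->
  measurable_fun [set: @Omega d E R] (continuing k v).
Proof.
move=> mv; apply: measurable_fun_ifT; first exact: measurable_aliveT.
  exact: (measurableT_comp mv (measurable_state s k)).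
exact: measurable_cst.
Qed.

Lemma integral_one_step x k v : measurable_fun [set: R * E] v ->
  (forall p, 0 <= v p) ->
  \int[P x]_w (if alive tau k.+1 w then one_step v (state s k w) else 0) =
  \int[P x]_w (running_cost k w + continuing k.+1 v w).
Proof.
move=> mv v0.
(* The guard is a function of the past alone, so [phi] depends on the past up to stage [k] and the
   next mark, as [markov] requires. *)
pose phi (p : @past d E R k * (R * E)) :=
  if alive tau k.+1 p.1 then step_cost c v (state s k p.1) p.2 else 0.
transitivity (\int[P x]_w \int[K (Xc k w)]_q phi (w, q)).
  apply: eq_integral => w _; rewrite /phi/=; case: ifP => // _.
  by rewrite integral0.
rewrite -markov.
- apply: eq_integral => w _; rewrite /phi /running_cost /continuing /=.
  case: ifP => // _; last by rewrite adde0.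
  by rewrite /step_cost /state/= ScS opprD addrA.
- by move=> p; rewrite /phi; case: ifP => // _; exact: step_cost_ge0.
- apply: measurable_fun_ifT; last exact: measurable_cst.
    have ma : measurable_fun [set: @past d E R k] (alive tau k.+1).
      exact: (@measurable_alive _ _ _ _ tauP k).
    by have := measurableT_comp ma (@measurable_fst _ _ (@past d E R k) (R * E)%type); exact.
  have m1 : measurable_fun [set: @past d E R k * (R * E)] (fun p => state s k p.1).
    exact: (measurableT_comp (measurable_state_past s (leqnn k)) measurable_fst).
  exact: (measurableT_comp (measurable_step_cost mc mv)
    (measurable_fun_pair m1 measurable_snd)).
Qed.

(** Both inequalities rest on this identity: it reduces a comparison of expectations between stages
    [k] and [k.+1] to a pointwise comparison at stage [k]. *)
Lemma integral_stage_cost x k v : measurable_fun [set: R * E] v ->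
  (forall p, 0 <= v p) ->
  \int[P x]_w (stage_cost c g tau s k w)%:E + \int[P x]_w continuing k.+1 v w =
  \int[P x]_w (halting_cost k w +
    (if alive tau k.+1 w then one_step v (state s k w) else 0)).
Proof.
move=> mv v0.
have mh := measurable_halting_cost k.
have mr := measurable_running_cost k.
have mk := measurable_continuing k.+1 mv.
have h0 w : 0 <= halting_cost k w by exact: halting_cost_ge0.
have r0 w : 0 <= running_cost k w by exact: running_cost_ge0.
have k0 w : 0 <= continuing k.+1 v w by exact: continuing_ge0.
have mo : measurable_fun [set: @Omega d E R]
    (fun w => if alive tau k.+1 w then one_step v (state s k w) else 0).
  apply: measurable_fun_ifT; first exact: measurable_aliveT.
    exact: (measurableT_comp (measurable_one_step K mc c0 mv v0) (measurable_state s k)).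
  exact: measurable_cst.
rewrite [RHS]ge0_integralD//; last first.
  by move=> w _; case: ifP => // _; exact: one_step_ge0.
rewrite integral_one_step// ge0_integralD//.
have -> : \int[P x]_w (stage_cost c g tau s k w)%:E =
    \int[P x]_w (halting_cost k w + running_cost k w).
  by apply: eq_integral => w _; exact: stage_costE.
by rewrite ge0_integralD// addeA.
Qed.

Lemma integral_continuing0 x v : measurable_fun [set: R * E] v ->
  (forall p, 0 <= v p) -> \int[P x]_w continuing 0 v w = v (s, x).
Proof.
move=> mv v0.
rewrite (ge0_ae_eq_integral (g := cst (v (s, x))))//.
- by rewrite integral_cst//= (_ : P x _ = 1) ?mule1//; exact: (probability_setT (P x)).
- exact: measurable_continuing.
- by move=> w _; exact: continuing_ge0.
- by move=> w _; exact: v0.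
- exists [set w | Xc 0 w <> x].
  split; [exact: measurableC (mstart x)|exact: startP|].
  move=> w /=; apply: contra_not => Xw _; rewrite /continuing /state /= Sc0 subr0 Xw.
  by rewrite /alive; case: (tau w).
Qed.

Lemma Vtau_stage_costs x :
  Vtau P c g tau s x = \sum_(k <oo) \int[P x]_w (stage_cost c g tau s k w)%:E.
Proof.
have ms k : measurable_fun [set: @Omega d E R] (fun w => (stage_cost c g tau s k w)%:E).
  rewrite (_ : (fun _ => _) = halting_cost k \+ running_cost k); last first.
    by apply/funext => w; exact: stage_costE.
  apply: emeasurable_funD; first exact: measurable_halting_cost.
  exact: measurable_running_cost.
have s0 k w : 0 <= (stage_cost c g tau s k w)%:E by rewrite lee_fin stage_cost_ge0.
rewrite -integral_nneseries//; apply: (ge0_eq_integral_off_null mN (N0 x)) => //.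
- move=> w; have cost0 u : 0 <= run_cost c w u.
    by apply: integral_ge0 => t _; rewrite lee_fin.
  by rewrite /reward; case: ifP => // _; rewrite adde_ge0// lee_fin.
- by move=> w; exact: nneseries_ge0.
- by move=> w /regN; exact: reward_regular.
Qed.

Lemma stage_costs_ge0 x k : 0 <= \int[P x]_w (stage_cost c g tau s k w)%:E.
Proof. by apply: integral_ge0 => w _; rewrite lee_fin stage_cost_ge0. Qed.

(** Induction on [n] for all [k]. At stage [k] the iterate [value n.+1] is at most [g] if [tau]
    stops there before the horizon, zero if the horizon has passed, and at most [one_step (value n)]
    if [tau] goes on. *)
Lemma continuing_value_le x n k :
  \int[P x]_w continuing k (value n) w <=
  \sum_(0 <= i < n) \int[P x]_w (stage_cost c g tau s (k + i)%N w)%:E.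
Proof.
elim: n k => [|n IH] k.
  rewrite big_geq// (eq_integral (cst 0)) ?integral0// => w _.
  by rewrite /continuing/=; case: ifP.
rewrite big_nat_recl//= addn0; under eq_bigr do rewrite -addSnnS.
have mv := measurable_value K mc c0 mg g0 n.
have v0 p : 0 <= value n p by exact: value_ge0.
apply: (@le_trans _ _ (\int[P x]_w (stage_cost c g tau s k w)%:E +
    \int[P x]_w continuing k.+1 (value n) w)); last by rewrite leeD2l.
rewrite integral_stage_cost//; apply: ge0_le_integral => //.
- by move=> w _; apply: continuing_ge0 => p; exact: (value_ge0 K c0 g0 n.+1 p).
- by apply: measurable_continuing; exact: (measurable_value K mc c0 mg g0 n.+1).
- apply: emeasurable_funD; first exact: measurable_halting_cost.
  apply: measurable_fun_ifT; first exact: measurable_aliveT.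
    exact: (measurableT_comp (measurable_one_step K mc c0 mv v0) (measurable_state s k)).
  exact: measurable_cst.
- move=> w _; rewrite /continuing /halting_cost.
  have o0 : 0 <= one_step (value n) (state s k w) by exact: one_step_ge0.
  case: ifP => aw; last by rewrite adde_ge0//; do 2 case: ifP => // _; rewrite lee_fin.
  case: eqP => tauk.
    rewrite /alive tauk ltnn adde0 /= subr_gt0; case: ifP => // _.
    by rewrite ge_min lexx.
  have -> : alive tau k.+1 w.
    move: aw tauk; rewrite /alive; case: (tau w) => // n' kn' kn.
    by rewrite ltn_neqAle kn' andbT; apply/eqP => kE; apply: kn; rewrite kE.
  by rewrite add0e /=; case: ifP => // _; rewrite ge_min lexx orbT.
Qed.

Lemma value_lim_le_Vtau x : value_lim (s, x) <= Vtau P c g tau s x.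
Proof.
rewrite Vtau_stage_costs; apply: (value_lim_le mc c0 mg g0) => n.
rewrite -(@integral_continuing0 x (value n)); last 2 first.
- exact: measurable_value.
- by move=> p; exact: value_ge0.
rewrite (le_trans (continuing_value_le x n 0))//.
by apply: nneseries_lim_ge => i _ _; exact: stage_costs_ge0.
Qed.

Hypothesis tau_hits : forall w, regular_path w ->
  (forall k, tau w = Some k -> (Sc k w < s)%R ->
     value_lim (state s k w) = (g (Xc k w))%:E) /\
  (forall k, alive tau k.+1 w -> (Sc k w < s)%R /\
     value_lim (state s k w) <> (g (Xc k w))%:E).

(** A supermartingale argument: cost paid so far plus limit value of the current state does not
    increase in expectation. Stopping before the horizon pays exactly the limit value, and
    continuing costs at most that by [value_lim_continuation]. *)
Lemma stage_costs_le x n :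
  \sum_(0 <= i < n) \int[P x]_w (stage_cost c g tau s i w)%:E +
  \int[P x]_w continuing n value_lim w <= value_lim (s, x).
Proof.
have mv := measurable_value_lim K mc c0 mg g0.
have v0 p : 0 <= value_lim p by exact: value_lim_ge0.
elim: n => [|n IH]; first by rewrite big_geq// add0e integral_continuing0.
rewrite (le_trans _ IH)// big_nat_recr//= -addeA leeD2l// integral_stage_cost//.
have mo : measurable_fun [set: @Omega d E R]
    (fun w => if alive tau n.+1 w then one_step value_lim (state s n w) else 0).
  apply: measurable_fun_ifT; first exact: measurable_aliveT.
    exact: (measurableT_comp (measurable_one_step K mc c0 mv v0) (measurable_state s n)).
  exact: measurable_cst.
have o0 p : 0 <= one_step value_lim p by exact: one_step_ge0.
(* [tau_hits] speaks of regular paths, so the integrands are compared off [N]. *)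
apply: ae_ge0_le_integral => //.
- by move=> w _; rewrite adde_ge0 ?halting_cost_ge0//; case: ifP.
- by apply: emeasurable_funD; first exact: measurable_halting_cost.
- by move=> w _; exact: continuing_ge0.
- exact: measurable_continuing.
- exists N; split; [exact: mN|exact: N0|]; move=> w /=.
  apply: contra_notP => /regN/tau_hits[hit cont] _.
  rewrite /continuing /halting_cost; case: eqP => tauk.
    rewrite /alive tauk ltnn leqnn adde0; case: ifP => // Sns.
    by rewrite (hit _ tauk).
  rewrite add0e; case: ifP => [an|_]; last by case: ifP.
  have [Sns vg] := cont _ an.
  have -> : alive tau n w.
    by move: an; rewrite /alive; case: (tau w) => // m /ltnW.
  apply: value_lim_continuation => //; first by rewrite /= subr_gt0.
  exact/eqP.
Qed.

Lemma Vtau_le_value_lim x : Vtau P c g tau s x <= value_lim (s, x).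
Proof.
rewrite Vtau_stage_costs; apply: lime_le.
  by apply: is_cvg_nneseries => k _ _; exact: stage_costs_ge0.
apply: nearW => n; rewrite (le_trans _ (stage_costs_le x n))//.
rewrite leeDl//; apply: integral_ge0 => w _.
by apply: continuing_ge0 => p; exact: value_lim_ge0.
Qed.

End one_stage.

(* The bound [b] mirrors the restriction [s <= T] in [Dstar]; it is inactive on
   regular paths, where [Sc k w >= 0]. *)
Definition stop_set (b : R) : set (R * E) :=
  [set p | (p.1 <= 0)%R \/ ((p.1 <= b)%R /\ value_lim p = (g p.2)%:E)].

Definition tau_hit b w := first_hit (fun n => stop_set b (state b n w)).

Lemma measurable_stop_set b : measurable (stop_set b).
Proof.
have mle r : measurable [set p : R * E | (p.1 <= r)%R].
  have := @measurable_fst _ _ R E measurableT `]-oo, r]%classic (measurable_itv _).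
  by rewrite setTI; congr (measurable _); apply/seteqP; split => p /=; rewrite in_itv.
have meq : measurable [set p : R * E | value_lim p = (g p.2)%:E].
  rewrite -[X in measurable X]setTI; apply: emeasurable_fun_eq => //.
    exact: measurable_value_lim.
  by apply/measurable_EFinP; exact: measurableT_comp.
exact: measurableU (mle 0%R) (measurableI _ _ (mle b) meq).
Qed.

Lemma stopping_time_tau_hit b : stopping_time (tau_hit b).
Proof. exact: stopping_time_first_hit (measurable_stop_set b). Qed.

Lemma Vtau_tau_hit b x : Vtau P c g (tau_hit b) b x = value_lim (b, x).
Proof.
apply/eqP; rewrite eq_le value_lim_le_Vtau ?andbT; last exact: stopping_time_tau_hit.
apply: Vtau_le_value_lim; first exact: stopping_time_tau_hit.
move=> w [T0 _]; split => [k /first_hit_SomeP[hk _] Skb|k ak].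
  by case: hk => [h0|[]//]; move: h0; rewrite /= subr_le0 leNgt Skb.
have nk : ~ stop_set b (state b k w).
  move: ak; rewrite /alive; case tauw : (tau_hit b w) => [n|].
    by move/first_hit_SomeP : tauw => [_ nh] kn; exact: nh.
  by move/first_hit_NoneP : tauw => nh _; exact: nh.
move/not_orP : nk => [nS nv]; split.
  by rewrite ltNge; apply/negP => bS; apply: nS; rewrite /= subr_le0.
move=> vE; apply: nv; split => //=.
by rewrite lerBlDr lerDl regular_Sc_ge0.
Qed.

(** Needed at every horizon [b], since [Dstar] evaluates [Vstar] at remaining horizons; the infimum
    at horizon [b] is attained by [tau_hit b]. *)
Lemma Vstar_value_lim b x : Vstar P c g b x = value_lim (b, x).
Proof.
apply/eqP; rewrite eq_le; apply/andP; split.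
  rewrite -Vtau_tau_hit; apply: ereal_inf_lbound; exists (tau_hit b) => //.
  exact: stopping_time_tau_hit.
apply: le_ereal_inf_tmp => _ [tau tauP <-]; exact: value_lim_le_Vtau.
Qed.

Lemma tau_star_tau_hit b : tau_star P c g b = tau_hit b.
Proof.
apply/funext => w; rewrite /tau_star omin_first_hit; congr first_hit.
apply/funext => n; apply/propext; rewrite /stop_set /Dstar /= Vstar_value_lim.
rewrite subr_le0; split.
  by move=> [[/andP[_ ?] ?]|?]; [right|left].
move=> [?|[? ?]]; first by right.
(* [Dstar] asks for a positive remaining horizon; when it is not positive, the second infimum of
   [tau_star] already applies. *)
by have [bS|Sb] := leP b (Sc n w); [right|left; rewrite subr_gt0 Sb].
Qed.

Lemma tau_hit_finite b x : P x [set w | tau_hit b w = None] = 0.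
Proof.
apply/eqP; rewrite eq_le measure_ge0 andbT -(N0 x) le_measure ?inE//.
  exact: measurable_None (@stopping_time_tau_hit b).
move=> w /first_hit_NoneP nh; apply: contrapT => /regN[_ /(_ b)[m bm]].
by apply: (nh m); left; rewrite /= subr_le0.
Qed.

End optimality.

Theorem theorem4p4 (d : measure_display) (E : measurableType d) (R : realType)
    (Q : R -> R.-spker E ~> E) (P : E -> probability (@Omega d E R) R)
    (c g : E -> R) (T : R) :
  borel_space E R ->
  semi_markov_kernel Q ->
  (exists delta eps : R, [/\ 0 < delta, 0 < eps &
     forall x : E, (Q delta x setT <= (1 - eps)%:E)%E]) ->
  measurable_fun setT c -> (forall x, 0 <= c x) ->
  measurable_fun setT g -> (forall x, 0 <= g x) ->
  0 <= T ->
  canonical_law Q P ->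
  [/\ stopping_time (tau_star P c g T),
      (forall x : E, Vtau P c g (tau_star P c g T) T x = Vstar P c g T x)
    & (forall x : E, P x [set w | tau_star P c g T w = None] = 0%E)].
Proof.
move=> bE smQ reg mc c0 mg g0 _ lawP.
have [K markov] := markov_property bE smQ lawP.
have [N [mN N0 regN]] := almost_all_paths_regular smQ lawP reg.
have mstart x := measurable_start bE x.
have startP := law_start bE lawP.
have starE := tau_star_tau_hit mc c0 mg g0 markov mstart startP mN N0 regN T.
(* [Dstar] involves an infimum over all stopping times, whose measurability is not evident;
   [tau_hit] is defined through the measurable function [value_lim]. *)
rewrite starE; split.
- exact: stopping_time_tau_hit.
- by move=> x; rewrite (Vstar_value_lim mc c0 mg g0 markov mstart startP mN N0 regN)
    (Vtau_tau_hit mc c0 mg g0 markov mstart startP mN N0 regN).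
- exact: (tau_hit_finite K mc c0 mg g0 mN N0 regN T).
Qed.
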